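(* For integers $n\ge2$ and $0\le t\le n-2$, the number of $(102,120)$-avoiding inversion sequences $e$ of length $n$ with $\mathrm{rank}(e)=t$ is $$\binom{2n-t-2}{n-t-1}-\binom{2n-2t-3}{n-t-1}.$$
   Context: An inversion sequence of length $n$ is an integer sequence $e=(e_1,\dots,e_n)$ with $0\le e_j\le j-1$ for all $j$. It contains a pattern $w=w_1w_2w_3$ if there are indices $i_1<i_2<i_3$ such that $e_{i_1}e_{i_2}e_{i_3}$ is order-isomorphic to $w$ (same relations $<,=,>$ between corresponding pairs of entries); otherwise it avoids $w$. ''$(w,w')$-avoiding'' means avoiding both $w$ and $w'$. $\max(e)$ is the largest entry, and $\mathrm{fdes}(e)$ is the position $p$ of the first descent: $e_1\le\cdots\le e_p>e_{p+1}$, with the convention $e_{n+1}=-1$. For a $102$-avoiding $e$, $\mathrm{rank}(e):=\mathrm{fdes}(e)-\max(e)-1$. *)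

(* Defs.v *)
From mathcomp Require Import all_boot all_order all_algebra.

Set Implicit Arguments.
Unset Strict Implicit.
Unset Printing Implicit Defensive.

Import Order.TTheory GRing.Theory Num.Theory.

(* Integer sequences e = (e_1, ..., e_n) with nonnegative entries are lists
   s : seq nat, with e_j = nth 0 s (j - 1). *)

(* 0 <= e_j <= j - 1 for all j; here i = j - 1. *)
Definition inversion_seq (s : seq nat) : bool :=
  [forall i : 'I_(size s), nth 0 s i <= i].

Definition order_iso (u v : seq nat) : bool :=
  (size u == size v) &&
  [forall a : 'I_(size u), forall b : 'I_(size u),
     ((nth 0 u a < nth 0 u b) == (nth 0 v a < nth 0 v b)) &&
     ((nth 0 u a == nth 0 u b) == (nth 0 v a == nth 0 v b))].

(* [w] is meant to be a pattern w_1 w_2 w_3 of length three. *)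
Definition contains (w s : seq nat) : bool :=
  [exists i1 : 'I_(size s), exists i2 : 'I_(size s), exists i3 : 'I_(size s),
     [&& i1 < i2, i2 < i3
       & order_iso [:: nth 0 s i1; nth 0 s i2; nth 0 s i3] w]].

Definition avoids (w s : seq nat) : bool := ~~ contains w s.

Definition max_entry (s : seq nat) : nat := \max_(x <- s) x.

(* The default value -1 of [nth] implements the convention e_{n+1} = -1, so for
   a nonempty s the search always succeeds, at the latest at the last entry.
   The final successor turns the index from 0 into a position from 1. *)
Definition fdes (s : seq nat) : nat :=
  let e i := nth (-1)%R [seq x%:Z%R | x <- s] i in
  (find (fun i => (e i.+1 < e i)%R) (iota 0 (size s))).+1.

Definition rank (s : seq nat) : int :=
  ((fdes s)%:Z - (max_entry s)%:Z - 1)%R.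

(* The entries of an inversion sequence of length n are all < n, so taking them
   in 'I_n loses nothing and makes the set finite. *)
Definition inv_102_120_rank (n t : nat) : {set n.-tuple 'I_n} :=
  [set e : n.-tuple 'I_n |
     let s := [seq val x | x <- e] in
     [&& inversion_seq s, avoids [:: 1; 0; 2] s, avoids [:: 1; 2; 0] s
       & rank s == t%:Z%R]].

(* Main.v *)
Require Import Defs.
From mathcomp Require Import all_boot all_order all_algebra zify.

Set Implicit Arguments.
Unset Strict Implicit.
Unset Printing Implicit Defensive.

(* Avoiding 102 and 120 together means that every letter is a weak minimum or a
   weak maximum of the letters after it.  Hence such a sequence of positive
   maximum m + 1 and rank t is a concatenation A ++ (m + 1)^(t - u + 1) ++ w: A is
   a weakly increasing inversion sequence of length m + u + 1 (0 <= u <= t) with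
   last entry a <= m, and w is a word over [a, m + 1] with the same
   minimum-or-maximum property that does not start with m + 1.  There are
   ballot (m + u + 1) a choices of A, and the number of choices of w depends only
   on m + 1 - a and on the length N - m of w, where N = n - t - 2.

   The sum conv N v of these products over m and a, with v = u + 1, equals
   'C(2N + v, N): the ballot recurrence gives
     conv (N + 1) (v + 1) = conv (N + 1) v + conv N (v + 2),
   and the recurrence on words gives
     conv (N + 1) 0 + Cat_N = 2 conv N 0 + conv N 1.
   Summing over u is then a hockey-stick identity. *)

(** * Ballot numbers *)

(* Number of weakly increasing inversion sequences of length q with last entry
   a; the empty sequence counts as having last entry 0. *)
Fixpoint ballot (q a : nat) : nat :=
  if q is q'.+1 then (a <= q') * \sum_(b < a.+1) ballot q' b else a == 0.

Arguments ballot : simpl never.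

Lemma ballotS q a : ballot q.+1 a = (a <= q) * \sum_(b < a.+1) ballot q b.
Proof. by []. Qed.

Lemma ballot_n0 q : ballot q 0 = 1.
Proof. by elim: q => // q IH; rewrite ballotS big_ord1 IH. Qed.

Lemma ballotSS q a : a < q -> ballot q.+1 a.+1 = ballot q a.+1 + ballot q.+1 a.
Proof.
move=> ltaq; rewrite !ballotS ltaq (ltnW ltaq) !mul1n.
by rewrite [in LHS]big_ord_recr /= addnC.
Qed.

Lemma ballot_diag q : ballot q.+1 q.+1 = 0.
Proof. by rewrite ballotS ltnn. Qed.

(** The ballot recurrence is Pascal's rule, so only the boundary matters: on the diagonal the ballot
    number vanishes and the two binomials agree by symmetry. *)
Lemma ballot_closed q a : a <= q ->
  ballot q.+1 a.+1 + 'C((q + a).+1, a) = 'C((q + a).+1, a.+1).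
Proof.
have diag m : ballot m.+1 m.+1 + 'C((m + m).+1, m) = 'C((m + m).+1, m.+1).
  by rewrite ballot_diag -[RHS]bin_sub; [congr 'C(_, _); lia | lia].
elim: q a => [|q IHq] a; first by rewrite leqn0 => /eqP->; apply: diag.
elim: a => [_|a IHa leaq].
  rewrite ballotSS // ballot_n0 addn0 bin0 bin1.
  by have := IHq 0 isT; rewrite !addn0 bin0 bin1; lia.
have [<-|neaq] := eqVneq a.+1 q.+1; first exact: diag.
rewrite ballotSS; last lia.
have := IHa (ltnW leaq).
have leaq' : a.+1 <= q by lia.
have := IHq _ leaq'.
rewrite !addnS !addSn !(binS (q + a).+2).
lia.
Qed.

(** The sum is the Catalan number Cat_q. *)
Lemma sum_ballot q : \sum_(a < q.+1) ballot q a + 'C(q.*2, q.+1) = 'C(q.*2, q).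
Proof.
have -> : \sum_(a < q.+1) ballot q a = ballot q.+1 q by rewrite ballotS leqnn mul1n.
case: q => [|q]; first by rewrite ballot_n0.
have := ballot_closed (leqnSn q).
have -> : (q.+1 + q).+1 = q.+1.*2 by lia.
suff -> : 'C(q.+1.*2, q.+2) = 'C(q.+1.*2, q) by [].
by rewrite -[LHS]bin_sub; [congr 'C(_, _); lia | lia].
Qed.

(** * Counting minimum-or-maximum words *)

(* Words of length l over d + 1 consecutive integers all of whose letters are
   minimal or maximal among the later ones.  If the first letter is the j-th, the
   rest lies weakly below it or weakly above it; the predecessor accounts for
   the constant word, which is counted twice. *)
Fixpoint good_words (d l : nat) : nat :=
  if l is l'.+1 then
    \sum_(j < d.+1) (good_words j l' + good_words (d - j) l').-1
  else 1.

(* The words of [good_words] whose first letter, if any, is not the largest. *)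
Definition tail_words (d l : nat) : nat :=
  if l is l'.+1 then \sum_(j < d) (good_words j l' + good_words (d - j) l').-1
  else 1.

Lemma good_words_gt0 d l : 0 < good_words d l.
Proof.
elim: l d => //= l IH d; rewrite big_ord_recl.
by have := IH 0; have := IH d; rewrite /= subn0; lia.
Qed.

(** Reflecting [j] to [d - j] makes the two halves of the sum equal; by positivity each predecessor
    costs exactly 1. *)
Lemma good_words_sum d l :
  good_words d l.+1 + d.+1 = (\sum_(j < d.+1) good_words j l).*2.
Proof.
have sum1 : \sum_(j < d.+1) 1 = d.+1 by rewrite sum1_card card_ord.
rewrite -[in LHS]sum1 -addnn [X in _ = _ + X](reindex_inj rev_ord_inj) /=.
rewrite -!big_split /=; apply: eq_bigr => j _; rewrite subSS.
by have := good_words_gt0 j l; lia.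
Qed.

Lemma good_wordsSS d l :
  good_words d.+1 l.+1 + 1 = good_words d l.+1 + (good_words d.+1 l).*2.
Proof.
have := good_words_sum d.+1 l; have := good_words_sum d l.
rewrite [in X in _ -> _ = X -> _]big_ord_recr /=; lia.
Qed.

Lemma good_words0 l : good_words 0 l = 1.
Proof. by elim: l => //= l IH; rewrite big_ord1 IH. Qed.

(** After a first letter that is the largest allowed, the rest is arbitrary. *)
Lemma tail_wordsE d l : tail_words d l.+1 + good_words d l = good_words d l.+1.
Proof.
by rewrite /= big_ord_recr /= subnn good_words0 addn1.
Qed.

Lemma tail_words0 l : tail_words 0 l.+1 = 0.
Proof. by rewrite /= big_ord0. Qed.

(* The correction [l == 0] is forced by the convention tail_words d 0 = 1. *)
Lemma tail_wordsSS d l : tail_words d.+1 l.+1 + (l == 0) =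
  (tail_words d.+1 l).*2 + tail_words d l.+1.
Proof.
have := good_wordsSS d l; have := tail_wordsE d.+1 l; have := tail_wordsE d l.
case: l => [|l]; first by rewrite /=; lia.
have := good_wordsSS d l; have := tail_wordsE d.+1 l; have := tail_wordsE d l.
by move: (tail_words _ _) (tail_words _ _) (tail_words _ _) => *; lia.
Qed.

(** * The convolution and its closed form *)

Definition conv (N v : nat) : nat :=
  \sum_(m < N.+1) \sum_(a < m.+1) ballot (m + v) a * tail_words (m - a).+1 (N - m).

Lemma conv0 v : conv 0 v = 1.
Proof. by rewrite /conv !big_ord1 ballot_n0. Qed.

(** The [a = 0] terms agree because [ballot _ 0 = 1]. In the others [ballotSS] splits the ballot
    number, and lowering [m] and [a] by one turns the second part into [conv N v.+2]. *)
Lemma convSS N v : conv N.+1 v.+1 = conv N.+1 v + conv N v.+2.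
Proof.
rewrite /conv.
under eq_bigr => m _ do rewrite big_ord_recl ballot_n0 mul1n.
under [X in _ = X + _]eq_bigr => m _ do rewrite big_ord_recl ballot_n0 mul1n.
rewrite !big_split /= -addnA; congr (_ + _).
rewrite big_ord_recl big_ord0 add0n [in RHS]big_ord_recl big_ord0 add0n.
rewrite -big_split; apply: eq_bigr => m _.
rewrite -big_split /=; apply: eq_bigr => a _.
move: (ltn_ord a); move: (nat_of_ord a) => b; rewrite /bump !leq0n !add1n => ltbm.
by rewrite -mulnDl !addSn !addnS ballotSS //; lia.
Qed.

Lemma conv0S N :
  conv N.+1 0 + \sum_(a < N.+1) ballot N a = (conv N 0).*2 + conv N 1.
Proof.
(* Shifting [m] by one in [conv N 1] aligns its rows with those of [conv N.+1 0]. *)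
pose f m a := if a < m then ballot m a * tail_words (m - a) (N.+1 - m) else 0.
have E1 : conv N 1 = \sum_(m < N.+2) \sum_(a < m.+1) f m a.
  rewrite big_ord_recl big_ord1 /f /= add0n /conv.
  apply: eq_bigr => m _; rewrite /bump leq0n add1n.
  rewrite [RHS]big_ord_recr /= ltnn addn0.
  by apply: eq_bigr => a _; rewrite ltn_ord addn1 subSS subSn // -ltnS.
rewrite E1 /conv [in LHS]big_ord_recr [X in _ = _ + X]big_ord_recr /=.
have -> : \sum_(a < N.+2) ballot (N.+1 + 0) a * tail_words (N.+1 - a).+1 (N.+1 - N.+1)
   = \sum_(a < N.+2) f N.+1 a.
  apply: eq_bigr => a _; rewrite /f subnn addn0 !muln1.
  case: ifP => // /negbT; rewrite -leqNgt => leNa.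
  have -> : nat_of_ord a = N.+1 by have := ltn_ord a; lia.
  exact: ballot_diag.
rewrite addnAC addnA; congr (_ + _).
(* The correction in [tail_wordsSS] survives only for [m = N], where it contributes this sum. *)
have -> : \sum_(a < N.+1) ballot N a =
    \sum_(m < N.+1) \sum_(a < m.+1) ballot m a * (N - m == 0).
  rewrite [RHS]big_ord_recr /= subnn eqxx [X in X + _]big1 => [|m _].
    by rewrite add0n; apply: eq_bigr => a _; rewrite muln1.
  by rewrite big1 // => a _; rewrite subn_eq0 leqNgt ltn_ord muln0.
rewrite -big_split -addnn -!big_split /=; apply: eq_bigr => m _.
rewrite -!big_split /=; apply: eq_bigr => a _.
have lemN : m <= N by rewrite -ltnS.
rewrite addn0 subSn // -mulnDr tail_wordsSS -addnn !mulnDr; congr (_ + _).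
rewrite /f subSn //; case: ltnP => // lema.
by rewrite (_ : m - a = 0) ?tail_words0 ?muln0 //; apply/eqP; rewrite subn_eq0.
Qed.

Lemma convE N v : conv N v = 'C(N.*2 + v, N).
Proof.
elim: N v => [|N IHN]; first by move=> v; rewrite conv0 bin0.
elim=> [|v IHv].
  have := conv0S N; have := sum_ballot N; rewrite !IHN !addn0 addn1 doubleS !binS.
  have -> : 'C((N.*2).+1, N) = 'C(N.*2.+1, N.+1).
    by rewrite -[RHS]bin_sub; [congr 'C(_, _); lia | lia].
  rewrite !binS; lia.
by rewrite convSS IHv IHN [in RHS]addnS [in RHS]binS doubleS !addSn !addnS.
Qed.

Lemma sum_conv N t :
  \sum_(u < t.+1) conv N u.+1 + 'C(N.*2.+1, N.+1) = 'C(N.*2 + t.+2, N.+1).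
Proof.
elim: t => [|t IHt]; first by rewrite big_ord1 convE addn1 addn2 binS addnC.
by rewrite big_ord_recr /= addnAC IHt convE [in RHS]addnS binS.
Qed.

(** * Counting words by their letters *)

(** Recursive summation over words, so that they can be cut and extended at both ends without casts
    between tuple types; [card_sumw] links it to cardinals. *)
Fixpoint sumw (k n : nat) (F : seq nat -> nat) : nat :=
  if n is n'.+1 then \sum_(x < k) sumw k n' (fun s => F (val x :: s)) else F [::].

Lemma eq_sumw k n F G :
  (forall s, size s = n -> all (fun x => x < k) s -> F s = G s) ->
  sumw k n F = sumw k n G.
Proof.
elim: n F G => [|n IH] F G eqFG; first exact: eqFG.
apply: eq_bigr => x _; apply: IH => s size_s lt_s.
by apply: eqFG; rewrite /= ?size_s ?ltn_ord.
Qed.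

Lemma sumw_sum k n N (F : nat -> seq nat -> nat) :
  sumw k n (fun s => \sum_(i < N) F i s) = \sum_(i < N) sumw k n (F i).
Proof.
elim: n F => //= n IH F; rewrite [RHS]exchange_big.
by apply: eq_bigr => x _; apply: (IH (fun i s => F i (val x :: s))).
Qed.

Lemma sumwD k n F G : sumw k n (fun s => F s + G s) = sumw k n F + sumw k n G.
Proof.
elim: n F G => //= n IH F G.
rewrite -big_split; apply: eq_bigr => x _.
exact: (IH (fun s => F (val x :: s)) (fun s => G (val x :: s))).
Qed.

Lemma sumwZ k n c F : sumw k n (fun s => c * F s) = c * sumw k n F.
Proof.
elim: n F => //= n IH F.
rewrite big_distrr; apply: eq_bigr => x _.
exact: (IH (fun s => F (val x :: s))).
Qed.

Lemma sumw0 k n : sumw k n (fun=> 0) = 0.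
Proof. exact: (sumwZ k n 0 (fun=> 0)). Qed.

(** This turns a decomposition by concatenation into a product of counts. *)
Lemma sumw_cat k q r F G :
  sumw k (q + r) (fun s => F (take q s) * G (drop q s)) = sumw k q F * sumw k r G.
Proof.
elim: q F => [|q IH] F; last first.
  by rewrite [RHS]big_distrl; apply: eq_bigr => x _; exact: (IH (fun s => F (val x :: s))).
rewrite -sumwZ; apply: eq_sumw => s _ _.
by rewrite take0 drop0.
Qed.

Lemma sumw_rcons k n F :
  sumw k n.+1 F = \sum_(x < k) sumw k n (fun s => F (rcons s x)).
Proof.
elim: n F => // n IH F.
transitivity (\sum_(y < k) sumw k n.+1 (fun s => F (val y :: s))); first by [].
under eq_bigr => y _ do rewrite (IH (fun s => F (val y :: s))).
by rewrite exchange_big.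
Qed.

Lemma card_sumw k n (P : pred (seq nat)) :
  #|[set e : n.-tuple 'I_k | P [seq val x | x <- e]]| = sumw k n (fun s => P s).
Proof.
rewrite -sum1dep_card big_mkcond /=.
rewrite (eq_bigr (fun e : n.-tuple 'I_k => P [seq val x | x <- e] : nat));
  last by move=> e _; case: ifP.
elim: n P => [|n IH] P.
  by rewrite (big_pred1 [tuple]) // => e; apply/esym/eqP/tuple0.
transitivity (\sum_(x < k) \sum_(e : n.-tuple 'I_k)
    (P (val x :: [seq val y | y <- e]) : nat)); last first.
  by apply: eq_bigr => x _; rewrite (IH (fun s => P (val x :: s))).
rewrite pair_bigA /= (reindex (fun p : 'I_k * n.-tuple 'I_k => cons_tuple p.1 p.2)) //=.
exists (fun e => (thead e, behead_tuple e)) => [[x e]|e] _ /=.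
  by congr (_, _); apply: val_inj.
by rewrite [RHS]tuple_eta.
Qed.

Lemma sum_ord_interval k a b (F : nat -> nat) : b <= k ->
  \sum_(x < k) (a <= x < b) * F x = \sum_(j < b - a) F (a + j).
Proof.
move=> lebk; transitivity (\sum_(a <= i < b) F i).
  rewrite (big_nat_widen _ _ k) // big_geq_mkord [RHS]big_mkcond /=.
  by apply: eq_bigr => x _; rewrite andbC; case: ifP => _; rewrite ?mul1n.
rewrite -{1}[a]add0n big_addn big_mkord.
by apply: eq_bigr => i _; rewrite addnC.
Qed.

Definition ninv_seq (a : nat) (s : seq nat) : bool :=
  [&& sorted leq s, inversion_seq s & last 0 s == a].

Lemma sum_eq_ord n (x : nat) : \sum_(i < n) (x == i :> nat) = (x < n).
Proof.
elim: n => [|n IH]; first by rewrite big_ord0.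
by rewrite big_ord_recr /= IH; lia.
Qed.

Lemma inversion_seqP s :
  reflect (forall i, i < size s -> nth 0 s i <= i) (inversion_seq s).
Proof.
apply: (iffP forallP) => [H i lti|H i]; first exact: (H (Ordinal lti)).
exact: H.
Qed.

Lemma inversion_rcons s x :
  inversion_seq (rcons s x) = inversion_seq s && (x <= size s).
Proof.
apply/inversion_seqP/andP => [H|[/inversion_seqP H lex] i].
  split; last by have := H (size s); rewrite nth_rcons ltnn eqxx size_rcons; apply.
  apply/inversion_seqP => i lti; have := H i.
  by rewrite nth_rcons lti size_rcons ltnS; apply; exact: ltnW.
rewrite size_rcons ltnS nth_rcons leq_eqVlt => /orP[/eqP->|lti].
  by rewrite ltnn eqxx.
by rewrite lti H.
Qed.

Lemma sorted_leq_rcons s x : sorted leq (rcons s x) = sorted leq s && (last 0 s <= x).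
Proof. by case: s => //= y s; rewrite rcons_path. Qed.

Lemma sumw_ninv k q a : a < k -> sumw k q (fun s => ninv_seq a s) = ballot q a.
Proof.
elim: q a => [|q IH] a ltak.
  by rewrite /= /ninv_seq /= eq_sym; case: inversion_seqP => // -[].
rewrite sumw_rcons ballotS (bigD1 (Ordinal ltak)) //= big1 ?addn0; last first.
  move=> x /negbTE nexa; rewrite -[RHS](sumw0 k q).
  apply: eq_sumw => s _ _; rewrite /ninv_seq last_rcons.
  have -> : (val x == a) = false by exact: nexa.
  by rewrite !andbF.
(* Here [b] is the last entry of what remains once the final letter [a] is removed. *)
transitivity ((a <= q) * \sum_(b < a.+1) sumw k q (fun s => ninv_seq b s)); last first.
  by congr (_ * _); apply: eq_bigr => b _; apply/IH/(leq_trans (ltn_ord b)).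
rewrite -(sumw_sum k q a.+1 (fun b s => ninv_seq b s)) -sumwZ; apply: eq_sumw => s size_s _.
rewrite /ninv_seq sorted_leq_rcons inversion_rcons last_rcons eqxx andbT size_s.
have -> : \sum_(b < a.+1) [&& sorted leq s, inversion_seq s & last 0 s == b] =
    [&& sorted leq s, inversion_seq s & last 0 s < a.+1] :> nat.
  case: (sorted leq s); last by rewrite big1.
  by case: (inversion_seq s); [exact: sum_eq_ord | rewrite big1].
rewrite ltnS mulnb.
by case: sorted; case: inversion_seq; case: (last 0 s <= a); case: (a <= q).
Qed.

Fixpoint good (s : seq nat) : bool :=
  if s is x :: s' then
    (all (fun y => y <= x) s' || all (fun y => x <= y) s') && good s'
  else true.

Definition good_in (a m : nat) (s : seq nat) : bool :=
  all (fun x => a <= x <= m) s && good s.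

Definition good_tail (a m : nat) (s : seq nat) : bool :=
  good_in a m s && (ohead s != Some m).

(** Inclusion-exclusion: the rest lies weakly below [x] or weakly above it, and both hold only for
    the constant word [x]. The additive form avoids truncated subtraction. *)
Lemma good_in_cons a m x s : a <= x <= m ->
  good_in a m (x :: s) + good_in x x s = good_in a x s + good_in x m s :> nat.
Proof.
move=> /andP[leax lexm]; rewrite /good_in /= leax lexm /=.
case: (good s); rewrite ?andbT ?andbF //=.
have sub b c : all (fun y => b <= y <= c) s =
    all (fun y => b <= y) s && all (fun y => y <= c) s by rewrite -all_predI.
rewrite !sub.
have le_trans b c : b <= c -> all (fun y => c <= y) s -> all (fun y => b <= y) s.
  by move=> lebc; apply: sub_all => y; apply: leq_trans.
have ge_trans b c : b <= c -> all (fun y => y <= b) s -> all (fun y => y <= c) s.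
  by move=> lebc; apply: sub_all => y /leq_trans; apply.
have /implyP := le_trans _ _ leax; have /implyP := ge_trans _ _ lexm.
move: (all (leq a) s) (all (leq x) s) (all (leq^~ x) s) (all (leq^~ m) s).
by do 4!case.
Qed.

(** The count for length [l] is a premise, so that the lemma serves both inside the induction for
    [sumw_good] and later for [sumw_good_tail]. *)
Lemma sumw_good_cons k l a m x :
  (forall b c, b <= c < k ->
     sumw k l (fun s => good_in b c s) = good_words (c - b) l) ->
  a <= x <= m -> m < k ->
  sumw k l (fun s => good_in a m (x :: s))
  = (good_words (x - a) l + good_words (m - x) l).-1.
Proof.
move=> IH axm ltmk; have /andP[leax lexm] := axm.
have := sumwD k l (fun s => good_in a m (x :: s)) (fun s => good_in x x s).
rewrite (eq_sumw (G := fun s => good_in a x s + good_in x m s)); last first.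
  by move=> s _ _; apply: good_in_cons.
rewrite sumwD !IH ?leax ?lexm ?leqnn //= ?(leq_ltn_trans lexm) //.
by rewrite subnn good_words0 addn1 => ->.
Qed.

Lemma sumw_good k l a m : a <= m < k ->
  sumw k l (fun s => good_in a m s) = good_words (m - a) l.
Proof.
elim: l a m => [|l IH] a m // /andP[leam ltmk].
pose F x := (good_words (x - a) l + good_words (m - x) l).-1.
transitivity (\sum_(x < k) (a <= x < m.+1) * F x); last first.
  rewrite sum_ord_interval // subSn //.
  by apply: eq_bigr => j _; rewrite /F addKn subnDA.
apply: eq_bigr => x _; rewrite ltnS.
have [axm|naxm] := boolP (a <= x <= m); last first.
  by rewrite mul0n -[RHS](sumw0 k l); apply: eq_sumw => s _ _; rewrite /good_in /= (negbTE naxm).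
by rewrite mul1n; apply: sumw_good_cons.
Qed.

Lemma sumw_good_tail k l a m : a <= m < k ->
  sumw k l (fun s => good_tail a m s) = tail_words (m - a) l.
Proof.
case: l => [|l] // /andP[leam ltmk].
pose F x := (good_words (x - a) l + good_words (m - x) l).-1.
transitivity (\sum_(x < k) (a <= x < m) * F x); last first.
  rewrite sum_ord_interval ?(ltnW ltmk) //.
  by apply: eq_bigr => j _; rewrite /F addKn subnDA.
apply: eq_bigr => x _.
have [/andP[leax ltxm]|naxm] := boolP (a <= x < m); last first.
  rewrite mul0n -[RHS](sumw0 k l); apply: eq_sumw => s _ _.
  rewrite /good_tail /good_in /= [x <= m]leq_eqVlt; apply/eqP; rewrite eqb0; apply/negP.
  case/andP=> /andP[/andP[/andP[leax /orP[/eqP->|ltxm]] _] _]; first by rewrite eqxx.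
  by rewrite leax ltxm in naxm.
rewrite mul1n /F -(sumw_good_cons (@sumw_good k l) (a := a) (m := m)) ?leax ?(ltnW ltxm) //.
apply: eq_sumw => s _ _; rewrite /good_tail; suff -> : ohead (val x :: s) != Some m by rewrite andbT.
by apply/eqP=> -[exm]; rewrite exm ltnn in ltxm.
Qed.

(** * Patterns, first descent and maximum *)

Lemma order_iso3 (u1 u2 u3 w1 w2 w3 : nat) :
  order_iso [:: u1; u2; u3] [:: w1; w2; w3] =
  [&& (u1 < u2) == (w1 < w2), (u2 < u1) == (w2 < w1),
      (u1 < u3) == (w1 < w3), (u3 < u1) == (w3 < w1),
      (u2 < u3) == (w2 < w3) & (u3 < u2) == (w3 < w2)].
Proof.
apply/andP/idP => [[_ /forallP H]|H].
  have lt0 : 0 < 3 by []. have lt1 : 1 < 3 by []. have lt2 : 2 < 3 by [].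
  have /forallP H0 := H (Ordinal lt0).
  have /forallP H1 := H (Ordinal lt1).
  have /forallP H2 := H (Ordinal lt2).
  have /andP[/= -> _] := H0 (Ordinal lt1).
  have /andP[/= -> _] := H0 (Ordinal lt2).
  have /andP[/= -> _] := H1 (Ordinal lt0).
  have /andP[/= -> _] := H1 (Ordinal lt2).
  have /andP[/= -> _] := H2 (Ordinal lt0).
  by have /andP[/= -> _] := H2 (Ordinal lt1).
split=> //; apply/forallP=> -[i lti]; apply/forallP=> -[j ltj] /=.
by move: i j lti ltj H => [|[|[|i]]] [|[|[|j]]] //= _ _; lia.
Qed.

Lemma containsP w1 w2 w3 s :
  reflect (exists i j l, [/\ i < j, j < l, l < size s &
             order_iso [:: nth 0 s i; nth 0 s j; nth 0 s l] [:: w1; w2; w3]])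
          (contains [:: w1; w2; w3] s).
Proof.
apply: (iffP existsP) => [[i /existsP[j /existsP[l /and3P[ltij ltjl iso]]]]|].
  by exists i, j, l.
move=> [i [j [l [ltij ltjl ltl iso]]]].
have ltj := ltn_trans ltjl ltl; have lti := ltn_trans ltij ltj.
exists (Ordinal lti); apply/existsP; exists (Ordinal ltj).
by apply/existsP; exists (Ordinal ltl); rewrite /= ltij ltjl.
Qed.

(** A letter with a strictly smaller one after it is not a weak minimum, hence must be a weak
    maximum. *)
Lemma goodP s :
  reflect (forall i j l, i < j < size s -> i < l < size s ->
             nth 0 s j < nth 0 s i -> nth 0 s l <= nth 0 s i)
          (good s).
Proof.
elim: s => [|x s IH] /=; first by apply: ReflectT => i j l; rewrite andbF.
apply: (iffP andP) => [[H /IH goods] [|i] [|j] [|l] //=|H].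
- rewrite !ltnS => ltj ltl ltjx; case/orP: H => /all_nthP H; first exact: H.
  by have := H 0 _ ltj; rewrite leqNgt ltjx.
- exact: goods.
split; last by apply/IH => i j l ltij ltil; apply: (H i.+1 j.+1 l.+1).
have [//|/allPn[y ys ltxy]] := boolP (all (leq x) s); first by rewrite orbT.
rewrite orbF -ltnNge in ltxy *.
apply/(all_nthP 0) => l ltl; apply: (H 0 (index y s).+1 l.+1) => //=.
  by rewrite ltnS index_mem.
by rewrite nth_index.
Qed.

(** A letter violates [good] when both a smaller and a larger one follow it; their order decides
    between 102 and 120. *)
Lemma avoids_good s :
  avoids [:: 1; 0; 2] s && avoids [:: 1; 2; 0] s = good s.
Proof.
apply/andP/goodP => [[/containsP no102 /containsP no120] i j l|H].
  move=> /andP[ltij ltj] /andP[ltil ltl] ltji; rewrite leqNgt; apply/negP => ltil'.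
  have [ltjl|ltlj|eqjl] := ltngtP j l; last by move: ltji ltil'; rewrite eqjl; lia.
    by apply: no102; exists i, j, l; split=> //; rewrite order_iso3; lia.
  by apply: no120; exists i, l, j; split=> //; rewrite order_iso3; lia.
split; apply/containsP => -[i [j [l [ltij ltjl ltl]]]]; rewrite order_iso3.
  by have := H i j l; lia.
by have := H i l j; lia.
Qed.

Lemma fdesP (s : seq nat) : s != [::] -> exists p,
  [/\ fdes s = p.+1, p < size s,
      p.+1 < size s -> nth 0 s p.+1 < nth 0 s p &
      forall i, i < p -> nth 0 s i <= nth 0 s i.+1].
Proof.
move=> s_neq0; rewrite /fdes; set d := (X in find X _).
(* The default -1 lies below every entry, so the last index always counts as a descent. *)
have dE i : i < size s -> d i = (i.+1 == size s) || (nth 0 s i.+1 < nth 0 s i).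
  move=> lti; rewrite /d [X in (_ < X)%R](nth_map 0) //.
  have [->|neqi] := eqVneq i.+1 (size s).
    by rewrite nth_default ?size_map.
  by rewrite (nth_map 0) ?ltz_nat // ltn_neqAle neqi.
have has_d : has d (iota 0 (size s)).
  apply/hasP; exists (size s).-1; first by rewrite mem_iota; case: (s) s_neq0 => //=; lia.
  by rewrite dE; case: (s) s_neq0 => //= *; rewrite eqxx.
have := has_d; rewrite has_find size_iota => ltp.
exists (find d (iota 0 (size s))); split=> //.
  move=> ltp'; have := nth_find 0 has_d; rewrite nth_iota // add0n dE //.
  by rewrite (ltn_eqF ltp').
move=> i ltip; have lti := ltn_trans ltip ltp.
have := before_find 0 ltip; rewrite nth_iota // add0n dE //.
by move=> /norP[_]; rewrite -leqNgt.
Qed.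

Lemma fdes_eq s p : p < size s ->
  (p.+1 < size s -> nth 0 s p.+1 < nth 0 s p) ->
  (forall i, i < p -> nth 0 s i <= nth 0 s i.+1) -> fdes s = p.+1.
Proof.
move=> ltp desp incp; have /fdesP[r [-> ltr desr incr]] : s != [::] by case: (s) ltp.
congr _.+1; case: (ltngtP r p) => // [ltrp|ltpr].
  by have := incp _ ltrp; have := desr (leq_ltn_trans ltrp ltp); lia.
by have := incr _ ltpr; have := desp (leq_ltn_trans ltpr ltr); lia.
Qed.

Lemma max_entry_eq s m : m \in s -> all (fun x => x <= m) s -> max_entry s = m.
Proof.
move=> ms /allP les; apply/eqP; rewrite eqn_leq; apply/andP; split.
  by apply/bigmax_leqP_seq => x xs _; apply: les.
by rewrite /max_entry; apply: leq_bigmax_seq.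
Qed.

(** * The decomposition *)

(* The decomposition A ++ m^j ++ w with size A = q and last entry a of A. *)
Definition shape (a m q j : nat) (s : seq nat) : bool :=
  ninv_seq a (take q s) &&
  ((take j (drop q s) == nseq j m) && good_tail a m (drop j (drop q s))).

Lemma sumw_nseq k j m : m < k -> sumw k j (fun s => s == nseq j m) = 1.
Proof.
move=> ltmk; elim: j => //= j IH.
rewrite (bigD1 (Ordinal ltmk)) //= big1 ?addn0 => [|x /negbTE nexm].
  by rewrite -[RHS]IH; apply: eq_sumw => s _ _; rewrite eqseq_cons eqxx.
rewrite -[RHS](sumw0 k j); apply: eq_sumw => s _ _.
by rewrite eqseq_cons; have -> : (val x == m) = false by exact: nexm.
Qed.

Lemma sumw_shape k a m q j r : a <= m < k ->
  sumw k (q + (j + r)) (fun s => shape a m q j s) = ballot q a * tail_words (m - a) r.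
Proof.
move=> lemk; have /andP[leam ltmk] := lemk.
rewrite -(@sumw_ninv k) ?(leq_ltn_trans leam) // -(sumw_good_tail _ lemk).
(* The middle block is forced and accounts for the factor 1. *)
rewrite -[X in _ = _ * X]mul1n -(sumw_nseq j ltmk) -!sumw_cat.
by apply: eq_sumw => s _ _; rewrite !mulnb.
Qed.

Definition in_class (t : nat) (s : seq nat) : bool :=
  [&& inversion_seq s, avoids [:: 1; 0; 2] s, avoids [:: 1; 2; 0] s
    & rank s == t%:Z%R].

Lemma in_classE t s :
  in_class t s = [&& inversion_seq s, good s & fdes s == (t + max_entry s).+1].
Proof.
rewrite -avoids_good /in_class -!andbA /rank; do 3!congr (_ && _).
by apply/eqP/eqP; lia.
Qed.

Lemma good_cat_sorted A r :
  sorted leq A -> all (leq (last 0 A)) r -> good r -> good (A ++ r).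
Proof.
elim: A => //= x A IH pathA allr goodr.
rewrite !all_cat (order_path_min leq_trans pathA) /=.
have lexl : x <= last x A.
  have /allP : all (leq x) (x :: A) by rewrite /= leqnn (order_path_min leq_trans).
  by apply; apply: mem_last.
have -> : all (leq x) r by apply: sub_all allr => y; apply: leq_trans lexl.
rewrite orbT /=; apply: IH => //; first exact: path_sorted pathA.
by move: allr; case: (A) => //= _; apply: sub_all.
Qed.

Lemma good_cat_nseq j m w : all (leq^~ m) w -> good w -> good (nseq j m ++ w).
Proof.
move=> lew goodw; elim: j => //= j IH.
by rewrite IH andbT all_cat lew all_nseq leqnn orbT.
Qed.

Lemma good_drop p s : good s -> good (drop p s).
Proof. by elim: p s => [|p IH] [|x s] //= /andP[_ /IH]. Qed.

(** The last [m] of the block has index [size A + j = t + m] counted from 0. Since [w] cannot start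
    with [m], the first descent is at position [t + m + 1], which is rank [t]. *)
Lemma cat_in_class t a m j A w :
  a < m -> m <= size A -> size A + j = t + m ->
  ninv_seq a A -> good_tail a m w ->
  let s := A ++ nseq j.+1 m ++ w in
  [/\ in_class t s, max_entry s = m & index m s = size A].
Proof.
move=> ltam lemA eqj /and3P[sortedA invA /eqP lastA].
case/andP=> /andP[in_w goodw] headw s.
have le_w : all (leq^~ m) w by apply: sub_all in_w => y /andP[].
have ge_w : all (leq a) w by apply: sub_all in_w => y /andP[].
have le_A x : x \in A -> x <= a.
  move=> /(nthP 0)[i /= lti <-]; rewrite -lastA -nth_last.
  apply: (sorted_leq_nth leq_trans leqnn) => //; rewrite ?inE /=; lia.
have mA : m \notin A by apply/negP => /le_A; rewrite leqNgt ltam.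
have max_s : max_entry s = m.
  apply: max_entry_eq; first by rewrite !mem_cat mem_nseq eqxx orbT.
  rewrite !all_cat le_w all_nseq leqnn orbT !andbT.
  by apply/allP => x /le_A /leq_trans; apply; exact: ltnW.
split=> //; last by rewrite index_cat (negbTE mA) /= eqxx addn0.
rewrite in_classE max_s; apply/and3P; split.
- apply/inversion_seqP => i lti; rewrite nth_cat; case: ltnP => [ltiA|leAi].
    exact: (inversion_seqP _ invA).
  (* Beyond [A] every entry is at most [m], and [m <= size A <= i]. *)
  apply: leq_trans (leq_trans lemA leAi).
  have : all (leq^~ m) (nseq j.+1 m ++ w) by rewrite all_cat le_w all_nseq leqnn orbT.
  by move/all_nthP; apply; move: lti; rewrite /s !size_cat /=; lia.
- apply: good_cat_sorted => //; last exact: good_cat_nseq.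
  by rewrite lastA all_cat ge_w all_nseq (ltnW ltam) orbT.
have nth_s i : nth 0 s i = if i < size A then nth 0 A i else
    if i - size A < j.+1 then m else nth 0 w (i - size A - j.+1).
  by rewrite !nth_cat size_nseq nth_nseq; case: (_ < j.+1).
apply/eqP/fdes_eq => [||i lti].
- rewrite !size_cat size_nseq; lia.
- rewrite !nth_s !size_cat size_nseq => ltw.
  have -> : (t + m < size A) = false by lia.
  have -> : ((t + m).+1 < size A) = false by lia.
  have -> : t + m - size A < j.+1 by lia.
  have -> : ((t + m).+1 - size A < j.+1) = false by lia.
  have -> : (t + m).+1 - size A - j.+1 = 0 by lia.
  case: (w) in_w headw ltw => [|x v] /=; first by lia.
  move=> /andP[/andP[_ lexm] _] neq _.
  by rewrite ltn_neqAle lexm andbT; apply: contraNneq neq => ->.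
rewrite !nth_s; case: (ltnP i.+1 (size A)) => [lti1|lei1].
  rewrite (ltnW lti1).
  by apply: (sorted_leq_nth leq_trans leqnn) => //; rewrite ?inE; lia.
rewrite (_ : i.+1 - size A < j.+1); last lia.
case: ltnP => [ltiA|leAi]; last by rewrite ifT //; lia.
by apply: leq_trans (ltnW ltam); apply/le_A/mem_nth.
Qed.

(** The last three equations recover [m], [q] and [a] from [s], so no sequence is decomposed
    twice. *)
Lemma shape_in_class t a m q j s :
  a < m -> m <= q -> q + j = t + m -> q + j < size s -> shape a m q j.+1 s ->
  [/\ in_class t s, max_entry s = m, index m s = q & last 0 (take q s) = a].
Proof.
move=> ltam lemq eqj ltq /andP[ninv /andP[/eqP take_j tail]].
have size_A : size (take q s) = q by rewrite size_takel //; lia.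
have := @cat_in_class t a m j (take q s) (drop j.+1 (drop q s)).
rewrite size_A -take_j !cat_take_drop => /(_ ltam lemq eqj ninv tail)[-> -> ->].
by case/and3P: ninv => _ _ /eqP->.
Qed.

Lemma in_class_shape t s (m := max_entry s) (q := index m s)
    (a := last 0 (take q s)) : t + 2 <= size s -> in_class t s ->
  [/\ a < m, m <= q <= t + m, t + m < size s & shape a m q (t + m - q).+1 s].
Proof.
move=> le_t; rewrite in_classE => /and3P[/inversion_seqP inv goods /eqP fdes_s].
have [|p [fdes_p ltp desp incp]] := @fdesP s; first by case: (s) le_t => //; rewrite addn2.
have {fdes_p} defp : p = t + m by move: fdes_p; rewrite fdes_s => -[<-].
have mono i i' : i <= i' -> i' <= p -> nth 0 s i <= nth 0 s i'.
  elim: i' => [|i' IH]; first by rewrite leqn0 => /eqP->.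
  rewrite leq_eqVlt => /orP[/eqP->//|lti] lti'.
  by apply: leq_trans (incp _ lti'); apply: IH => //; exact: ltnW.
(* The entry at [p] exceeds the next one, if any; by goodness it then bounds all later entries, and
   it bounds the earlier ones by monotonicity. *)
have le_p i : i < size s -> nth 0 s i <= nth 0 s p.
  move=> lti; have [leip|ltpi] := leqP i p; first exact: mono.
  have ltp1 := leq_ltn_trans ltpi lti.
  apply: (goodP _ goods p p.+1); rewrite ?ltnSn ?ltpi ?desp //.
have nth_p : nth 0 s p = m.
  apply/esym/max_entry_eq; first exact: mem_nth.
  by apply/(all_nthP 0) => i; apply: le_p.
have ms : m \in s by rewrite -nth_p mem_nth.
have nth_q : nth 0 s q = m by rewrite nth_index.
have ltq : q < size s by rewrite index_mem.
have leqp : q <= p.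
  rewrite leqNgt; apply/negP => /(before_find 0) /=.
  by rewrite nth_p eqxx.
have lemq : m <= q by rewrite -nth_q inv.
(* The zero sequence has rank [size s - 1], which [t + 2 <= size s] excludes. *)
have m_gt0 : 0 < m.
  rewrite lt0n; apply/eqP => m0.
  have [/desp|] := boolP (p.+1 < size s); first by rewrite nth_p m0.
  by rewrite defp m0; lia.
have defa : a = nth 0 s q.-1.
  by rewrite /a -nth_last size_takel ?(ltnW ltq) // nth_take //; lia.
have ltam : a < m.
  rewrite ltn_neqAle -{2}nth_p defa mono ?andbT; try lia.
  have /(before_find 0)/= : q.-1 < q by lia.
  by move=> ->.
have mid i : q <= i <= p -> nth 0 s i = m.
  by move=> /andP[leqi leip]; apply/eqP; rewrite eqn_leq -{1}nth_p -nth_q !mono.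
split=> //; rewrite -?defp ?lemq //.
have eqpq : q + (p - q).+1 = p.+1 by lia.
apply/and3P; split.
- apply/and3P; split=> //.
    apply/(sortedP 0) => i; rewrite size_takel ?(ltnW ltq) // => lti.
    by rewrite !nth_take; [apply: incp | |]; lia.
  apply/inversion_seqP => i; rewrite size_takel ?(ltnW ltq) // => lti.
  by rewrite nth_take //; apply/inv/(ltn_trans lti).
- apply/eqP/(@eq_from_nth _ 0); rewrite size_takel ?size_nseq ?size_drop //; try lia.
  move=> i lti; rewrite nth_take // nth_drop nth_nseq lti mid //; lia.
rewrite drop_drop addnC eqpq /good_tail /good_in good_drop // andbT.
apply/andP; split.
  apply/(all_nthP 0) => i; rewrite size_drop nth_drop => lti.
  rewrite -nth_p le_p ?andbT; last lia.
  (* A letter below [a] in the tail, together with the [m] at index [q], would violate goodness at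
     the entry [a] of index [q - 1]. *)
  rewrite leqNgt; apply/negP => lta.
  suff : m <= a by rewrite leqNgt ltam.
  rewrite -nth_q defa; apply: (goodP _ goods _ (p.+1 + i)); rewrite -?defa //; lia.
have [ltp1|] := ltnP p.+1 (size s); last by move/drop_oversize->.
rewrite (drop_nth 0 ltp1) /=; apply/eqP => -[eqm].
by have := desp ltp1; rewrite eqm nth_p ltnn.
Qed.

(** * Summing over all decompositions *)

Lemma sum_ord_single N i (F : nat -> nat) : i < N ->
  (forall j, j < N -> j != i -> F j = 0) -> \sum_(j < N) F j = F i.
Proof.
move=> ltiN F0; rewrite (bigD1 (Ordinal ltiN)) //= big1 ?addn0 // => j neji.
exact: F0.
Qed.

Lemma in_class_sum t N s : size s = N + t.+2 ->
  in_class t s = \sum_(u < t.+1) \sum_(m < N.+1) \sum_(a < m.+1)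
    shape a m.+1 (m + u.+1) (t - u).+1 s :> nat.
Proof.
move=> size_s.
have shapeE u m a : u < t.+1 -> m < N.+1 -> a < m.+1 ->
    shape a m.+1 (m + u.+1) (t - u).+1 s ->
    [/\ in_class t s, max_entry s = m.+1, index m.+1 s = m + u.+1
      & last 0 (take (m + u.+1) s) = a].
  by move=> ltu ltm lta; apply: shape_in_class; lia.
have [cls|ncls] := boolP (in_class t s); last first.
  rewrite big1 // => u _; rewrite big1 // => m _; rewrite big1 // => a _.
  apply/eqP; rewrite eqb0; apply: contra ncls => sh.
  by have [] := shapeE _ _ _ (ltn_ord u) (ltn_ord m) (ltn_ord a) sh.
have [|ltam leq_q lt_tm sh] := @in_class_shape t s _ cls; first by lia.
have m_gt0 : 0 < max_entry s by apply: leq_ltn_trans ltam.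
(* The only nonzero term: the maximum is [m0 + 1], and its first occurrence lies [u0] places beyond
   the earliest index allowed. *)
pose m0 := (max_entry s).-1; pose u0 := index (max_entry s) s - max_entry s.
have max_s : max_entry s = m0.+1 by rewrite /m0 prednK.
have idx_s : index (max_entry s) s = m0 + u0.+1 by rewrite /u0; lia.
have len : t + max_entry s - index (max_entry s) s = t - u0 by rewrite /u0; lia.
move: sh ltam; rewrite len idx_s max_s; set a0 := last _ _ => sh lta0.
have ltu0 : u0 < t.+1 by rewrite /u0; lia.
have ltm0 : m0 < N.+1 by rewrite /m0; lia.
rewrite (@sum_ord_single _ u0 (fun u => \sum_(m < N.+1) \sum_(a < m.+1)
    (shape a m.+1 (m + u.+1) (t - u).+1 s : nat))) //; last first.
  move=> u ltu neu; rewrite big1 // => m _; rewrite big1 // => a _.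
  apply/eqP; rewrite eqb0; apply: contraNN neu.
  case/(shapeE _ _ _ ltu (ltn_ord m) (ltn_ord a)) => _ eqm eqi _.
  by apply/eqP; move: idx_s; rewrite max_s in eqm *; rewrite eqm; lia.
rewrite (@sum_ord_single _ m0 (fun m => \sum_(a < m.+1)
    (shape a m.+1 (m + u0.+1) (t - u0).+1 s : nat))) //; last first.
  move=> m ltm nem; rewrite big1 // => a _.
  apply/eqP; rewrite eqb0; apply: contraNN nem.
  case/(shapeE _ _ _ ltu0 ltm (ltn_ord a)) => _ eqm _ _.
  by apply/eqP; lia.
rewrite (@sum_ord_single _ a0 (fun a =>
    shape a m0.+1 (m0 + u0.+1) (t - u0).+1 s : nat)) //; first by rewrite sh.
move=> a lta nea; apply/eqP; rewrite eqb0; apply: contraNN nea.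
by case/(shapeE _ _ _ ltu0 ltm0 lta) => _ _ _ <-.
Qed.

Lemma card_class t N :
  #|inv_102_120_rank (N + t.+2) t| = \sum_(u < t.+1) conv N u.+1.
Proof.
set k := N + t.+2.
rewrite -[LHS]/#|[set e : k.-tuple 'I_k | in_class t [seq val x | x <- e]]|.
rewrite card_sumw.
rewrite (eq_sumw (G := fun s => \sum_(u < t.+1) \sum_(m < N.+1) \sum_(a < m.+1)
    (shape a m.+1 (m + u.+1) (t - u).+1 s : nat))); last first.
  by move=> s size_s _; apply: in_class_sum.
rewrite (sumw_sum k k t.+1 (fun u s => \sum_(m < N.+1) \sum_(a < m.+1)
    (shape a m.+1 (m + u.+1) (t - u).+1 s : nat))).
apply: eq_bigr => u _.
rewrite (sumw_sum k k N.+1 (fun m s => \sum_(a < m.+1)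
    (shape a m.+1 (m + u.+1) (t - u).+1 s : nat))).
apply: eq_bigr => m _.
rewrite (sumw_sum k k m.+1 (fun a s =>
    (shape a m.+1 (m + u.+1) (t - u).+1 s : nat))).
apply: eq_bigr => a _.
have ltu := ltn_ord u; have ltm := ltn_ord m; have lta := ltn_ord a.
have lek : a <= m.+1 < k by rewrite /k; lia.
rewrite -(subSn (lta : a <= m)) -(sumw_shape (m + u.+1) (t - u).+1 (N - m) lek).
(* The lengths [m + u + 1], [t - u + 1] and [N - m] of the three pieces add up to [k]. *)
by congr sumw; rewrite /k; lia.
Qed.

Theorem proposition5p9 (n t : nat) (hn : 2 <= n) (ht : t <= n - 2) :
  (#|inv_102_120_rank n t|%:Z =
   'C(2 * n - t - 2, n - t - 1)%:Z - 'C(2 * n - 2 * t - 3, n - t - 1)%:Z)%R.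
Proof.
have [N ->] : exists N, n = N + t.+2 by exists (n - t.+2); lia.
rewrite card_class.
have -> : 2 * (N + t.+2) - t - 2 = N.*2 + t.+2 by lia.
have -> : 2 * (N + t.+2) - 2 * t - 3 = N.*2.+1 by lia.
have -> : N + t.+2 - t - 1 = N.+1 by lia.
by rewrite -sum_conv; lia.
Qed.
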